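(* Let $(f,p):(F,A)_G\to(H,B)_K$ be a morphism in the soft group category $SGp$. If both $f$ and $p$ are injective, then the morphism $(f,p)$ is monic in $SGp$.
   Context: A soft group $(F,A)_G$ over a group $G$ is a pair consisting of a set $A$ of parameters (a subset of some set $E$ of parameters) and a function $F:A\to P(G)$ into the power set of $G$ such that $F(a)$ is a subgroup of $G$ for every $a\in A$. For a group homomorphism $f:G\to K$, $\hat f:P(G)\to P(K)$ denotes the direct image map $\hat f(S)=f(S)$. A soft group homomorphism $(f,p):(F,A)_G\to(H,B)_K$ is a pair consisting of a group homomorphism $f:G\to K$ and a function $p:A\to B$ such that $\hat f\circ F=H\circ p$. Two soft group homomorphisms $(f,p)$ and $(g,q)$ are equal if and only if $f=g$ and $p=q$. $SGp$ is the category whose objects are soft groups (over arbitrary groups and parameter sets), whose morphisms are soft group homomorphisms, with componentwise composition $(g,q)\circ(f,p)=(g\circ f,q\circ p)$ and identities $(1_G,1_A)$. *)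

(* Defs.v *)
From HB Require Import structures.
From mathcomp Require Import all_boot.
From mathcomp Require Import boolp classical_sets.

Set Implicit Arguments.
Unset Strict Implicit.
Unset Printing Implicit Defensive.

Local Open Scope classical_set_scope.
Local Open Scope group_scope.

Record category := Category {
  obj :> Type;
  hom : obj -> obj -> Type;
  idm : forall X : obj, hom X X;
  comp : forall X Y Z : obj, hom Y Z -> hom X Y -> hom X Z;
  comp_idl : forall (X Y : obj) (h : hom X Y), comp (idm Y) h = h;
  comp_idr : forall (X Y : obj) (h : hom X Y), comp h (idm X) = h;
  compA : forall (X Y Z W : obj) (h : hom Z W) (k : hom Y Z) (l : hom X Y),
    comp h (comp k l) = comp (comp h k) l }.

Definition monic (C : category) (X Y : C) (m : hom X Y) : Prop :=
  forall (Z : C) (u v : hom Z X), comp m u = comp m v -> u = v.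

(* [groupType] also carries a choice structure, which every group has in the
   presence of the axioms of [boolp] and which morphisms need not respect.
   A parameter set (a subset of some set of parameters) is a type.
   [group_closed S] says that S contains 1 and is closed under x / y. *)
Record softGroup := SoftGroup {
  sg_group : groupType;
  sg_param : Type;
  sg_fun : sg_param -> set sg_group;
  sg_subgroup : forall a : sg_param, group_closed [in sg_fun a] }.

Definition direct_image (G K : Type) (f : G -> K) : set G -> set K :=
  fun S => f @` S.

(* [UMagmaMorphism.type] is the type of maps preserving 1 and products:
   between groups, the group homomorphisms. *)
Record softHom (X Y : softGroup) := SoftHom {
  sh_group : UMagmaMorphism.type (sg_group X) (sg_group Y);
  sh_param : sg_param X -> sg_param Y;
  sh_compat :
    direct_image sh_group \o @sg_fun X = @sg_fun Y \o sh_param }.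

Lemma group_morphism_eq (G K : groupType) (f g : UMagmaMorphism.type G K) :
  (f : G -> K) = g -> f = g.
Proof.
case: f g => [f [[f1] [fM]]] [g [[g1] [gM]]] /= efg; case: _ / efg g1 gM => g1 gM.
by rewrite (Prop_irrelevance f1 g1) (Prop_irrelevance fM gM).
Qed.

Lemma softHom_eq (X Y : softGroup) (h k : softHom X Y) :
  h = k <->
  (sh_group h : sg_group X -> sg_group Y) = sh_group k /\
  sh_param h = sh_param k.
Proof.
split=> [-> //|[]]; case: h k => [f p hp] [g q kq] /= /group_morphism_eq efg epq.
case: _ / efg kq => kq; case: _ / epq kq => kq.
by rewrite (Prop_irrelevance hp kq).
Qed.

Definition softHom_id (X : softGroup) : softHom X X.
Proof.
exists (idfun : UMagmaMorphism.type (sg_group X) (sg_group X)) id.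
by apply/funext => a; rewrite /direct_image /= image_id.
Defined.

Definition softHom_comp (X Y Z : softGroup)
  (k : softHom Y Z) (h : softHom X Y) : softHom X Z.
Proof.
exists (sh_group k \o sh_group h :
          UMagmaMorphism.type (sg_group X) (sg_group Z))
       (sh_param k \o sh_param h).
apply/funext => a; rewrite /direct_image /= -image_comp.
have /(congr1 (fun F => F a)) := sh_compat h; rewrite /direct_image /= => ->.
by have /(congr1 (fun F => F (sh_param h a))) := sh_compat k.
Defined.

Definition SGp : category.
Proof.
apply: (@Category softGroup softHom softHom_id softHom_comp).
- by move=> X Y h; apply/softHom_eq.
- by move=> X Y h; apply/softHom_eq.
- by move=> X Y Z W h k l; apply/softHom_eq.
Defined.

(* Main.v *)
Require Import Defs.
From HB Require Import structures.
From mathcomp Require Import all_boot.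
From mathcomp Require Import boolp classical_sets.

(** Composition in [SGp] is componentwise, and by [softHom_eq] a morphism is
    determined by its two underlying functions; so left cancellation of [h]
    reduces to left cancellation of two injective functions. *)
Theorem theorem3p7 (X Y : softGroup) (h : softHom X Y)
  (inj_group : injective (sh_group h)) (inj_param : injective (sh_param h)) :
  monic (C := SGp) (X := X) (Y := Y) h.
Proof.
move=> Z u v /softHom_eq[eq_group eq_param]; apply/softHom_eq; split.
- by apply/funext => x; apply: inj_group; exact: (congr1 (@^~ x) eq_group).
- by apply/funext => a; apply: inj_param; exact: (congr1 (@^~ a) eq_param).
Qed.
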